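(* Let $n\in\{3,4,5\}$ and let $\Lambda_A=A\mathbb{Z}^n$ be a lattice of rank $n$, where the column vectors of $A=(a_{ij})\in GL(n,\mathbb{R})$ form a Korkine-Zolotarev reduced basis and $A$ is in the normalized form: $A$ is upper triangular, $a_{11}=|A_1|=1$ and $a_{ii}=|A_i^\perp|>0$ for $2\le i\le n$. For any $\xi=(\xi_1,\ldots,\xi_n)^T\in\Lambda_A^*\setminus\{0\}$, $$\|\xi\|^4\ \ge\ \sum_{i=1}^n\frac{\xi_i^2}{a_{ii}^2}.$$ Furthermore, for a fixed $\xi\in\Lambda_A^*\setminus\{0\}$, equality holds if and only if $\xi=\pm\frac{e_i}{a_{ii}}$ for some $i\in\{1,\ldots,n\}$ such that $a_{ij}=0$ for all $j>i$. In particular, if equality holds for a collection of vectors spanning $\mathbb{R}^n$, then $A$ is diagonal.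
   Context: $e_1,\dots,e_n$ is the standard basis of $\mathbb{R}^n$, $\|\cdot\|$ the Euclidean norm. The dual lattice of $\Lambda_A$ is $\Lambda_A^*=\{\xi\in\mathbb{R}^n:\langle\xi,\lambda\rangle\in\mathbb{Z}\text{ for all }\lambda\in\Lambda_A\}$. Let $A_1,\dots,A_n$ be the columns of $A$, and let $A_i^\perp$ be the orthogonal projection of $A_i$ onto $\mathrm{Span}\{A_1,\dots,A_{i-1}\}^\perp$ (so $A_1^\perp=A_1$). The basis $\{A_1,\ldots,A_n\}$ of $\Lambda_A$ is Korkine-Zolotarev reduced if and only if: (1) for all $1\le i<j\le n$, $|\langle A_j,A_i^\perp\rangle|\le\frac12\|A_i^\perp\|^2$; (2) $A_1$ is one of the shortest non-zero vectors of $\Lambda_A$; (3) for each $2\le i\le n$, $A_i^\perp$ is one of the shortest non-zero vectors in the orthogonal projection of $\Lambda_A$ onto $\mathrm{Span}\{A_1,\ldots,A_{i-1}\}^\perp$. Every lattice can be brought, up to an orthogonal transformation and a dilation, to the normalized upper triangular form in the claim. *)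

(* Defs.v *)
From mathcomp Require Import all_boot all_order all_algebra.
From mathcomp Require Import boolp classical_sets reals.

Set Implicit Arguments.
Unset Strict Implicit.
Unset Printing Implicit Defensive.

Import Order.TTheory GRing.Theory Num.Theory.
Local Open Scope ring_scope.
Local Open Scope classical_set_scope.

(* Vectors of R^n are column vectors; indices run over 'I_n = {0, ..., n-1}. *)

Section Euclidean.
Context {R : realType} {n : nat}.
Implicit Types u v : 'cV[R]_n.

Definition dotv u v : R := \sum_(i < n) u i 0 * v i 0.

Definition enorm u : R := Num.sqrt (dotv u u).

Definition stdbasis (i : 'I_n) : 'cV[R]_n := delta_mx i 0.

(* The span of an arbitrary set of vectors is all of R^n. *)
Definition spans_space (S : set 'cV[R]_n) : Prop :=
  forall v, exists2 s : seq 'cV[R]_n,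
    (forall u, u \in s -> S u) & v \in <<s>>%VS.

(* MathComp subspaces are row spaces, hence the transpositions below. The
   row space of [kermx W^T] consists of the vectors orthogonal to every row
   of W. *)
Definition orthcompl (W : 'M[R]_n) : 'M[R]_n := kermx W^T.

Definition orthproj_compl (W : 'M[R]_n) v : 'cV[R]_n :=
  (v^T *m proj_mx (orthcompl W) <<W>>%MS)^T.

Definition shortest_nonzero (S : set 'cV[R]_n) v : Prop :=
  [/\ S v, v != 0 & forall w, S w -> w != 0 -> enorm v <= enorm w].

End Euclidean.

Section OrthogonalProjection.
Context {R : realType} {n : nat}.
Implicit Types (u v : 'cV[R]_n) (W : 'M[R]_n).

Lemma dotvE u v : dotv u v = (u^T *m v) 0 0.
Proof. by rewrite mxE; apply: eq_bigr => i _; rewrite mxE. Qed.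

Lemma dotv_eq0 u : dotv u u = 0 -> u = 0.
Proof.
move/eqP; rewrite psumr_eq0 => [/allP u0|i _]; last by rewrite -expr2 sqr_ge0.
apply/matrixP => i j; rewrite ord1 mxE; apply/eqP.
by have /= := u0 i (mem_index_enum i); rewrite mulf_eq0 orbb.
Qed.

Lemma orthcomplP W u :
  reflect (forall v, (v^T <= W)%MS -> dotv u v = 0) (u^T <= orthcompl W)%MS.
Proof.
apply: (iffP sub_kermxP) => [uW v /submxP[D vE]|uW].
  rewrite dotvE -[v]trmxK vE trmx_mul mulmxA uW mul0mx.
  by rewrite mxE.
apply/matrixP => i j; rewrite ord1 [RHS]mxE.
have := uW (row j W)^T; rewrite trmxK dotvE row_sub => /(_ isT) <-.
by rewrite !mxE; apply: eq_bigr => k _; rewrite !mxE.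
Qed.

Lemma orthcompl_cap0 W : (orthcompl W :&: <<W>> = 0)%MS.
Proof.
apply/eqP/rowV0P => r; rewrite sub_capmx genmxE -[r]trmxK => /andP[] /orthcomplP.
by move=> h /h /dotv_eq0 ->; rewrite trmx0.
Qed.

Lemma orthcompl_full W v : (v^T <= orthcompl W + <<W>>)%MS.
Proof.
apply: submx_full; rewrite /row_full mxrank_disjoint_sum ?orthcompl_cap0 //.
by rewrite mxrank_gen mxrank_ker mxrank_tr subnK // rank_leq_row.
Qed.

Lemma orthproj_compl_sub W v : ((orthproj_compl W v)^T <= orthcompl W)%MS.
Proof. by rewrite trmxK proj_mx_sub. Qed.

Lemma orthproj_compl_sub_compl W v : ((v - orthproj_compl W v)^T <= W)%MS.
Proof.
rewrite -(genmxE W) linearB /= trmxK.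
by rewrite proj_mx_compl_sub ?orthcompl_full.
Qed.

End OrthogonalProjection.

Section Lattice.
Context {R : realType} {n : nat}.
Implicit Types A : 'M[R]_n.

Definition lattice A : set 'cV[R]_n :=
  [set v | exists z : 'cV[int]_n, v = A *m map_mx intr z].

Definition dual_lattice A : set 'cV[R]_n :=
  [set xi | forall v, lattice A v -> dotv xi v \is a Num.int].

(* Span of the columns of A of index < i. *)
Definition prev_span A (i : 'I_n) : 'M[R]_n :=
  (\sum_(k < n | (k < i)%N) <<(col k A)^T>>)%MS.

Definition col_perp A (i : 'I_n) : 'cV[R]_n :=
  orthproj_compl (prev_span A i) (col i A).

Definition KZ_reduced A : Prop :=
  [/\ forall i j : 'I_n, (i < j)%N ->
        `|dotv (col j A) (col_perp A i)| <= 2^-1 * enorm (col_perp A i) ^+ 2,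
      forall i : 'I_n, i = 0%N :> nat -> shortest_nonzero (lattice A) (col i A)
    & forall i : 'I_n, (0 < i)%N ->
        shortest_nonzero (orthproj_compl (prev_span A i) @` lattice A)
          (col_perp A i)].

Definition KZ_normalized A : Prop :=
  [/\ forall i j : 'I_n, (j < i)%N -> A i j = 0,
      forall i : 'I_n, i = 0%N :> nat ->
        A i i = enorm (col i A) /\ enorm (col i A) = 1
    & forall i : 'I_n, (0 < i)%N ->
        A i i = enorm (col_perp A i) /\ 0 < enorm (col_perp A i)].

End Lattice.

(* Main.v *)
Require Import Defs.
From mathcomp Require Import all_boot all_order all_algebra.
From mathcomp Require Import boolp classical_sets reals.
From mathcomp Require Import ring lra zify.

Import Order.TTheory GRing.Theory Num.Theory.
Local Open Scope ring_scope.
Local Open Scope classical_set_scope.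

(** Write [D_k] for the squared pivot [a_kk ^ 2], [p_k] for [xi_k ^ 2] and [s]
    for the sum of the [p_k], so that the claim compares [s ^ 2] with
    [t = \sum p_k / D_k].

    Pivots of a Korkine-Zolotarev basis cannot decay fast:
    [D_(i+1) >= 3/4 D_i] ([KZ_three_fourths]) and [D_(i+2) >= 2/3 D_i]
    ([KZ_two_thirds]), hence [D_j >= D_i / 2] for [i <= j <= i + 3]
    ([KZ_half]) and [D_j >= D_i / 4] for [i <= j <= i + 4] ([KZ_quarter]).
    The bound [2/3] is the classical one for ternary forms ([ternary_min]); the
    chain [2/3 * 3/4 = 1/2] is what makes the constant [2] available up to
    [i + 3].

    Let [i] be the first index with [xi_i <> 0]. Triangularity and duality make
    [xi_i * a_ii] a nonzero integer ([dual_first]). If its square is at least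
    [4], then [s >= 4 / D_i >= 1 / D_k] for all [k >= i], which gives
    [t < s ^ 2] term by term. Otherwise [p_i = 1 / D_i] and, with [q] the sum of
    the [p_j] over [j > i],
      [s ^ 2 - t = q ^ 2 + \sum_(j > i) p_j * (2 / D_i - 1 / D_j)].
    The terms with [j <= i + 3] are nonnegative. Only [j = i + 4] may contribute
    negatively; there [1 / D_(i+4) <= 2 / D_(i+1)], and since the pairing of [xi]
    with the column [i + 1] is an integer and [a_(i,i+1) / a_ii] is at most [1/2]
    in absolute value, [1 / D_(i+1) <= p_i + p_(i+1)] ([inv_pivot_succ]). The
    loss is thus at most [2 * p_(i+1) * p_(i+4) <= q ^ 2 / 2], and
    [s ^ 2 - t >= q ^ 2 / 2] ([dual_gap]).

    Equality therefore forces [q = 0] and [xi = +- e_i / a_ii]; pairing this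
    vector with the column [j > i] gives the integer [+- a_ij / a_ii] of absolute
    value at most [1/2], so [a_ij = 0] ([dual_eq_case]). A spanning family of
    equality cases has for every [i] a member with nonzero [i]-th coordinate,
    hence a multiple of [e_i], so row [i] of [A] vanishes right of the diagonal. *)

Set Implicit Arguments.
Unset Strict Implicit.
Unset Printing Implicit Defensive.

(** * Minima of ternary forms *)

(** If [m <= 1/3] the first lower bound is at least [3/4 * 8/9]. If [m > 1/3]
    the second one bounds [1 + c] by [1 / (3 * m * (1 - m))], a value at which
    the first lower bound is still at least [2/3] because
    [(1 - 2 * m) * (3 * m - 1) >= 0]. Both endpoints occur: [m = 1/2, c = 1/3]
    for the face-centred cubic lattice, [m = 1/3, c = 1/2] for the body-centred
    one. *)
Lemma two_thirds_le (F : realFieldType) (m c z : F) :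
  0 <= m <= 1/2 -> 0 <= c <= 1/2 ->
  (1 - c ^+ 2) * (1 - m ^+ 2) <= z -> 2 * (1 + c) * m * (1 - m) <= z ->
  2/3 <= z.
Proof.
move=> /andP[m0 m1] /andP[c0 c1] h1 h2.
have [m3|m3] := leP m (1/3).
  apply: le_trans h1.
  have hc : 3/4 <= 1 - c ^+ 2 by nra.
  have hm : 8/9 <= 1 - m ^+ 2 by nra.
  nra.
rewrite leNgt; apply/negP => z23.
pose P := m * (1 - m).
have P0 : 2/9 < P by rewrite /P; nra.
have P1 : P <= 1/4 by rewrite /P; nra.
have X1 : 3 * P * (1 + c) < 1 by rewrite /P; lra.
(* [(1 + c) * (1 - c)] decreases in [c]: compare it with its value at
   [1 + c = 1 / (3 * P)]. *)
have H1 : 0 <= (1 - 3 * P * (1 + c)) * (1 + 3 * P * (1 + c) - 6 * P).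
  by apply: mulr_ge0; nra.
have H2 : 6 * P - 1 <= 9 * P ^+ 2 * (1 - c ^+ 2) by lra.
have m2 : 0 <= 1 - m ^+ 2 by nra.
have H3 : (6 * P - 1) * (1 - m ^+ 2) <= 9 * P ^+ 2 * ((1 - c ^+ 2) * (1 - m ^+ 2)).
  by rewrite [leRHS]mulrA; apply: ler_wpM2r.
have H4 : 6 * P ^+ 2 <= (6 * P - 1) * (1 - m ^+ 2).
  have -> : (6 * P - 1) * (1 - m ^+ 2)
     = 6 * P ^+ 2 + (1 - m) * ((1 - 2 * m) * (3 * m - 1)) by rewrite /P; ring.
  by rewrite lerDl; apply: mulr_ge0; [lra | apply: mulr_ge0; lra].
have : 9 * P ^+ 2 * ((1 - c ^+ 2) * (1 - m ^+ 2)) < 9 * P ^+ 2 * (2/3).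
  rewrite ltr_pM2l ?(le_lt_trans h1) //.
  by rewrite mulr_gt0 // exprn_gt0 //; lra.
lra.
Qed.

(** The setting is a reduced ternary basis with first pivot [1]: [a], [b], [c] are
    the absolute values of its size-reduced entries, [y] and [z] the other two
    squared pivots, and [d] the first coordinate of a lattice vector whose second
    and third coordinates have squares [y * (1 - c) ^ 2] and [z]. With [m] the
    minimum of [a] and [b], eliminating [y] gives the two bounds of
    [two_thirds_le]. The first one follows from [y >= 1 - a ^ 2] if [m = a], and
    if [m = b] by weighting the second and third conditions with [c ^ 2] and
    [1 - c ^ 2]. For the second one, the weights [1 - c] and [1 + c] on the second
    and fourth conditions give [z >= (1 + c) / 2 * (1 - d ^ 2)]. *)
Lemma ternary_bound (F : realFieldType) (a b c d y z : F) :
  0 <= a <= 1/2 -> 0 <= b <= 1/2 -> 0 <= c <= 1/2 ->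
  0 <= d <= 1 - 2 * Num.min a b ->
  1 <= y + a ^+ 2 -> y <= z + y * c ^+ 2 -> 1 <= z + y * c ^+ 2 + b ^+ 2 ->
  1 <= z + y * (1 - c) ^+ 2 + d ^+ 2 -> 2/3 <= z.
Proof.
move=> /andP[a0 a1] /andP[b0 b1] c01 /andP[d0 d1] h1 h2 h3 h4.
have /andP[c0 c1] := c01.
set m := Num.min a b in d1.
have m0 : 0 <= m by rewrite le_min a0.
have m1 : m <= 1/2 by rewrite ge_min a1.
have c2 : 0 <= 1 - c ^+ 2 by nra.
apply: (@two_thirds_le _ m c) => //; first by rewrite m0.
  rewrite /m minEle; case: ifP => _.
    have : (1 - c ^+ 2) * (1 - a ^+ 2) <= (1 - c ^+ 2) * y.
      by apply: ler_wpM2l => //; lra.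
    lra.
  have : (1 - c ^+ 2) * (1 - b ^+ 2) <= (1 - c ^+ 2) * (z + y * c ^+ 2).
    by apply: ler_wpM2l => //; lra.
  have : 0 <= c ^+ 2 * (z + y * c ^+ 2 - y) by apply: mulr_ge0; [nra|lra].
  lra.
have k2 : 0 <= (1 - c) * (z + y * c ^+ 2 - y) by apply: mulr_ge0; lra.
have k4 : (1 + c) * (1 - d ^+ 2) <= (1 + c) * (z + y * (1 - c) ^+ 2).
  by apply: ler_wpM2l; lra.
have kd : (1 + c) * d ^+ 2 <= (1 + c) * (1 - 2 * m) ^+ 2.
  apply: ler_wpM2l; first lra.
  by rewrite ler_pXn2r ?nnegrE //; lra.
lra.
Qed.

(** Reduction to [ternary_bound]: [k] is chosen to turn [w] into
    [+- (1 - |w|)]. If [k * u] and [v] have the same sign, a further shift [l]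
    makes the first coordinate [1 - |u| - |v|] up to sign; otherwise it already
    is [|u| - |v|]. *)
Lemma ternary_min_normalized (F : realFieldType) (u v w y z : F) :
  `|u| <= 1/2 -> `|v| <= 1/2 -> `|w| <= 1/2 ->
  1 <= u ^+ 2 + y -> y <= y * w ^+ 2 + z ->
  (forall k l : int, 1 <= (l%:~R + k%:~R * u + v) ^+ 2
                        + y * (k%:~R + w) ^+ 2 + z) ->
  2/3 <= z.
Proof.
move=> hu hv hw h1 h2 h.
pose k : int := if 0 <= w then -1 else 1.
have kw : (k%:~R + w) ^+ 2 = (1 - `|w|) ^+ 2.
  by rewrite /k; case: ger0P => _; rewrite ?rmorphN /= ?rmorph1; ring.
pose r := k%:~R * u + v.
have rE : r = `|u| + `|v| \/ r = - (`|u| + `|v|) \/ `|r| = `| `|u| - `|v| |.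
  have [] : r = u + v \/ r = v - u.
    by rewrite /r /k; case: ifP => _; rewrite ?rmorphN /= ?rmorph1; [right|left]; ring.
  - move=> ->; case: (ger0P u) => ?; case: (ger0P v) => ?.
    + by left.
    + by right; right; rewrite opprK.
    + by right; right; rewrite -normrN; congr `|_|; ring.
    + by right; left; ring.
  - move=> ->; case: (ger0P u) => ?; case: (ger0P v) => ?.
    + by right; right; rewrite distrC.
    + by right; left; ring.
    + by left; ring.
    + by right; right; congr `|_|; ring.
have [l [d [d0 dm ld]]] : exists l : int, exists d : F,
    [/\ 0 <= d, d <= 1 - 2 * Num.min `|u| `|v| & (l%:~R + r) ^+ 2 = d ^+ 2].
  case: rE => [->|[->|rE]].
  - exists (-1), (1 - `|u| - `|v|); split; first lra.
      by rewrite minEle; case: ifP; lra.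
    by rewrite rmorphN /= rmorph1; ring.
  - exists 1, (1 - `|u| - `|v|); split; first lra.
      by rewrite minEle; case: ifP; lra.
    by rewrite rmorph1; ring.
  - exists 0, (`|r|); split => //; last by rewrite rmorph0 add0r real_normK ?num_real.
    have := normr_ge0 u; have := normr_ge0 v.
    rewrite rE minEle; case: (leP `|u| `|v|) => uv.
      by rewrite (ler0_norm (x := `|u| - `|v|)); lra.
    by rewrite (ger0_norm (x := `|u| - `|v|)); lra.
apply: (@ternary_bound _ `|u| `|v| `|w| d y); rewrite ?normr_ge0 ?d0 //.
- by rewrite real_normK ?num_real // addrC.
- by rewrite real_normK ?num_real // addrC.
- have := h 0 0; rewrite rmorph0 mul0r !add0r !real_normK ?num_real //; lra.
- by have := h k l; rewrite -[l%:~R + _ + v]addrA -/r ld kw; lra.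
Qed.

(** The basis in question is [(a, 0, 0)], [(u, b, 0)], [(v, w, c)]; the last
    condition says that no lattice vector with third coordinate [c] is shorter
    than the first basis vector. *)
Lemma ternary_min (F : realFieldType) (a u v b w c : F) : 0 < a -> 0 < b ->
  `|u| <= a / 2 -> `|v| <= a / 2 -> `|w| <= b / 2 ->
  a ^+ 2 <= u ^+ 2 + b ^+ 2 -> b ^+ 2 <= w ^+ 2 + c ^+ 2 ->
  (forall k l : int, a ^+ 2 <= (l%:~R * a + k%:~R * u + v) ^+ 2
                        + (k%:~R * b + w) ^+ 2 + c ^+ 2) ->
  2/3 * a ^+ 2 <= c ^+ 2.
Proof.
move=> a0 b0 hu hv hw h1 h2 h.
have an0 : a != 0 by rewrite gt_eqF.
have bn0 : b != 0 by rewrite gt_eqF.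
have a2 : 0 < a ^+ 2 by rewrite exprn_gt0.
rewrite -ler_pdivlMr //.
have nb (p s : F) : 0 < s -> `|p| <= s / 2 -> `|p / s| <= 1 / 2.
  by move=> s0 ps; rewrite normrM normfV (gtr0_norm s0) ler_pdivrMr //; lra.
apply: (@ternary_min_normalized _ (u / a) (v / a) (w / b) (b ^+ 2 / a ^+ 2));
  rewrite ?nb //.
- have -> : (u / a) ^+ 2 + b ^+ 2 / a ^+ 2 = (u ^+ 2 + b ^+ 2) / a ^+ 2 by field.
  by rewrite ler_pdivlMr // mul1r.
- have -> : b ^+ 2 / a ^+ 2 * (w / b) ^+ 2 + c ^+ 2 / a ^+ 2
    = (w ^+ 2 + c ^+ 2) / a ^+ 2 by field; rewrite an0.
  by rewrite ler_pM2r ?invr_gt0.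
- move=> k l; have := h k l.
  set X := (X in _ <= X -> _) => hX.
  have -> : (l%:~R + k%:~R * (u / a) + v / a) ^+ 2 +
     b ^+ 2 / a ^+ 2 * (k%:~R + w / b) ^+ 2 + c ^+ 2 / a ^+ 2 = X / a ^+ 2.
    by rewrite /X; field; rewrite an0.
  by rewrite ler_pdivlMr // mul1r.
Qed.

(** * Sums over final segments of indices *)

Section FinalSegments.
Context {V : nmodType} {n : nat}.
Implicit Types i j k h : 'I_n.

Lemma sum_first i (F : 'I_n -> V) : (forall k, (k < i)%N -> F k = 0) ->
  \sum_(k < n) F k = F i + \sum_(k < n | (i < k)%N) F k.
Proof.
move=> F0; rewrite (bigD1 i) //=; congr +%R.
rewrite [LHS]big_mkcond [RHS]big_mkcond; apply: eq_bigr => k _.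
case: ltngtP => [ik|ki|/val_inj ->]; last by rewrite eqxx.
  by rewrite neq_ltn ik orbT.
by rewrite neq_ltn ki F0.
Qed.

Lemma tail_sum_step i j (F : 'I_n -> V) : j = i.+1 :> nat ->
  \sum_(k < n | (i <= k)%N) F k = F i + \sum_(k < n | (j <= k)%N) F k.
Proof.
move=> ji; rewrite (bigD1 i) //=; congr +%R; apply: eq_bigl => k.
by rewrite ji ltn_neqAle andbC eq_sym.
Qed.

Lemma tail_sum_last h (F : 'I_n -> V) :
  (forall k, (h < k)%N -> F k = 0) -> \sum_(k < n | (h <= k)%N) F k = F h.
Proof.
move=> F0; rewrite (bigD1 h) //= big1 ?addr0 // => k /andP[hk kh].
by apply: F0; rewrite ltn_neqAle eq_sym kh.
Qed.

End FinalSegments.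

(** * Projections along the leading columns of a triangular basis *)

Section Geometry.
Context {R : realType} {n : nat}.
Implicit Types (A W : 'M[R]_n) (u v w : 'cV[R]_n) (i j k h : 'I_n).

Lemma enorm_sqr v : enorm v ^+ 2 = \sum_(k < n) v k 0 ^+ 2.
Proof.
rewrite /enorm sqr_sqrtr /dotv; last by apply: sumr_ge0 => k _; rewrite -expr2 sqr_ge0.
by apply: eq_bigr => k _; rewrite expr2.
Qed.

Lemma orthproj_compl_unique W v w :
  (w^T <= orthcompl W)%MS -> ((v - w)^T <= W)%MS -> orthproj_compl W v = w.
Proof.
move=> wW vwW; rewrite /orthproj_compl -(subrK w v) linearD /= mulmxDl.
by rewrite proj_mx_0 ?orthcompl_cap0 ?genmxE // proj_mx_id ?orthcompl_cap0 // add0r trmxK.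
Qed.

Definition tail i v : 'cV[R]_n := \col_k (if (k < i)%N then 0 else v k 0).

Lemma enorm_tail i v : enorm (tail i v) ^+ 2 = \sum_(k < n | (i <= k)%N) v k 0 ^+ 2.
Proof.
rewrite enorm_sqr [RHS]big_mkcond; apply: eq_bigr => k _; rewrite mxE.
by case: ltnP => _; rewrite ?expr0n.
Qed.

Section Triangular.
Context {A : 'M[R]_n}.
Context (tri : forall i j, (j < i)%N -> A i j = 0).
Context (dpos : forall i, 0 < A i i).

Lemma prev_span_supp i v : (v^T <= prev_span A i)%MS ->
  forall k, (i <= k)%N -> v k 0 = 0.
Proof.
move=> vi k ik.
have : (prev_span A i <= kermx (delta_mx k 0 : 'cV[R]_n))%MS.
  apply/sumsmx_subP => j ji; rewrite genmxE; apply/sub_kermxP.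
  rewrite -colE; apply/matrixP => x y; rewrite !mxE tri //.
  exact: leq_trans ji ik.
move/(submx_trans vi)/sub_kermxP/matrixP/(_ 0 0).
by rewrite -colE !mxE.
Qed.

(** Back substitution: the coordinates of [v] in the basis of columns vanish from
    index [i] on, as those of [v] do. *)
Lemma supp_prev_span i v : (forall k, (i <= k)%N -> v k 0 = 0) ->
  (v^T <= prev_span A i)%MS.
Proof.
move=> v0.
have A_unit : A \in unitmx.
  rewrite -unitmx_tr unitmxE det_trig ?unitfE.
    by apply/prodf_neq0 => k _; rewrite mxE gt_eqF.
  by apply/is_trig_mxP => k l kl; rewrite mxE tri.
pose z := invmx A *m v.
have vE : v = A *m z by rewrite mulKVmx.
have z0 : forall k, (i <= k)%N -> z k 0 = 0.
  move=> k; have [m] := ubnP (n - k); elim: m k => // m IH k nk ik.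
  have := v0 k ik; rewrite vE mxE (bigD1 k) //= big1 ?addr0.
    by move/eqP; rewrite mulf_eq0 gt_eqF //= => /eqP.
  move=> l lk; have [lk'|kl] := ltnP l k; first by rewrite tri // mul0r.
  have kl' : (k < l)%N by rewrite ltn_neqAle eq_sym lk.
  rewrite IH ?mulr0 //; last exact: leq_trans ik kl.
  by have := ltn_ord l; lia.
have -> : v^T = \sum_k z k 0 *: (col k A)^T.
  rewrite vE; apply/matrixP => x y; rewrite summxE !mxE.
  by apply: eq_bigr => k _; rewrite !mxE ord1 mulrC.
apply: summx_sub => k _; have [ki|ik] := ltnP k i; last by rewrite z0 // scale0r sub0mx.
by apply: scalemx_sub; apply: (sumsmx_sup k) => //; rewrite genmxE.
Qed.

Lemma orthproj_prev_span i v : orthproj_compl (prev_span A i) v = tail i v.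
Proof.
apply: orthproj_compl_unique.
  apply/orthcomplP => u /prev_span_supp u0; rewrite /dotv big1 // => k _; rewrite mxE.
  by case: ltnP => [|ik]; rewrite ?mul0r // u0 // mulr0.
by apply: supp_prev_span => k ik; rewrite !mxE ltnNge ik /= subrr.
Qed.

Lemma col_perp_triangular i : col_perp A i = A i i *: stdbasis i.
Proof.
rewrite /col_perp orthproj_prev_span; apply/matrixP => k l.
rewrite ord1 !mxE andbT; case: ltngtP => [ki|ik|/val_inj ->].
- by rewrite (negbTE (_ : k != i)) ?mulr0 // neq_ltn ki.
- by rewrite tri // (negbTE (_ : k != i)) ?mulr0 // neq_ltn ik orbT.
- by rewrite eqxx mulr1.
Qed.

End Triangular.
End Geometry.

(** * Pivots of a Korkine-Zolotarev basis *)

Section Reduced.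
Context {R : realType} {n : nat} {A : 'M[R]_n}.
Implicit Types (v : 'cV[R]_n) (i j h : 'I_n).
Context (A_KZ : KZ_reduced A) (A_norm : KZ_normalized A).

Lemma KZ_triangular i j : (j < i)%N -> A i j = 0.
Proof. by case: A_norm => + _ _; apply. Qed.

Lemma KZ_diag_gt0 i : 0 < A i i.
Proof.
case: A_norm => _ h0 hpos; have [i0|i0] := posnP i.
  by have [-> ->] := h0 i i0; rewrite ltr01.
by have [-> ->] := hpos i i0.
Qed.

Lemma KZ_col_perp i : col_perp A i = A i i *: stdbasis i.
Proof. by apply: col_perp_triangular => [k l|k]; [exact: KZ_triangular|exact: KZ_diag_gt0]. Qed.

Lemma dotv_stdbasis v (a : R) i : dotv v (a *: stdbasis i) = v i 0 * a.
Proof.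
rewrite /dotv (bigD1 i) //= big1 => [|k ki]; first by rewrite !mxE !eqxx mulr1 addr0.
by rewrite !mxE (negbTE ki) !mulr0.
Qed.

Lemma enorm_col_perp i : enorm (col_perp A i) = A i i.
Proof.
by rewrite /enorm KZ_col_perp dotv_stdbasis !mxE !eqxx mulr1 -expr2 sqrtr_sqr gtr0_norm ?KZ_diag_gt0.
Qed.

Lemma KZ_size_reduced i j : (i < j)%N -> `|A i j| <= A i i / 2.
Proof.
case: A_KZ => size _ _ /size; rewrite enorm_col_perp KZ_col_perp dotv_stdbasis mxE.
have ai := KZ_diag_gt0 i; rewrite normrM (gtr0_norm ai) expr2 mulrA ler_pM2r //.
by rewrite mulrC.
Qed.

(** The minimality conditions for the first and the later columns, in one form: for
    [i = 0] nothing is projected away. *)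
Lemma KZ_shortest i v : lattice A v -> (exists2 k : 'I_n, (i <= k)%N & v k 0 != 0) ->
  A i i ^+ 2 <= \sum_(k < n | (i <= k)%N) v k 0 ^+ 2.
Proof.
move=> Av [k ik vk].
have tail_neq0 : tail i v != 0.
  by apply: contra_neq vk => /matrixP/(_ k 0); rewrite !mxE ltnNge ik.
rewrite -enorm_tail ler_pXn2r ?nnegrE ?sqrtr_ge0 ?(ltW (KZ_diag_gt0 i)) //.
have [i0|i0] := posnP i.
  have vE : tail i v = v.
    by apply/matrixP => x y; rewrite ord1 mxE i0.
  have [_ hn _] := A_norm; have [-> _] := hn i i0.
  by case: A_KZ => _ /(_ i i0)[_ _ sh] _; rewrite vE in tail_neq0 *; apply: sh.
rewrite -enorm_col_perp; case: A_KZ => _ _ /(_ i i0)[_ _]; apply => //.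
exists v => //; apply: orthproj_prev_span => [a b|a]; first exact: KZ_triangular.
exact: KZ_diag_gt0.
Qed.

Lemma lattice_col i : lattice A (col i A).
Proof. by exists (delta_mx i 0); rewrite map_delta_mx -colE. Qed.

Lemma lattice_comb3 (l k : int) i j h :
  lattice A (l%:~R *: col i A + k%:~R *: col j A + col h A).
Proof.
exists (l *: delta_mx i 0 + k *: delta_mx j 0 + delta_mx h 0).
by rewrite !map_mxD !map_mxZ !map_delta_mx !mulmxDr -!scalemxAr -!colE.
Qed.

Lemma KZ_pivot_succ i j : j = i.+1 :> nat -> A i i ^+ 2 <= A i j ^+ 2 + A j j ^+ 2.
Proof.
move=> ji; have ij : (i <= j)%N by rewrite ji.
apply: le_trans (@KZ_shortest i _ (lattice_col j) _) _.
  by exists j => //; rewrite mxE gt_eqF ?KZ_diag_gt0.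
rewrite (tail_sum_step _ ji) tail_sum_last ?mxE // => k jk.
by rewrite mxE KZ_triangular ?expr0n.
Qed.

Lemma KZ_three_fourths i j : j = i.+1 :> nat -> 3/4 * A i i ^+ 2 <= A j j ^+ 2.
Proof.
move=> ji; have := KZ_pivot_succ ji.
have := KZ_size_reduced (_ : i < j)%N; rewrite ji leqnn => /(_ isT).
rewrite -(ler_pXn2r (n := 2)) ?nnegrE //; last by have := KZ_diag_gt0 i; lra.
by rewrite real_normK ?num_real //; lra.
Qed.

Lemma KZ_two_thirds i h : h = i.+2 :> nat -> 2/3 * A i i ^+ 2 <= A h h ^+ 2.
Proof.
move=> hi; have jn : (i.+1 < n)%N by have := ltn_ord h; lia.
pose j := Ordinal jn.
apply: (@ternary_min _ _ (A i j) (A i h) (A j j) (A j h)); rewrite ?KZ_diag_gt0 //.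
- by apply: KZ_size_reduced.
- by apply: KZ_size_reduced; rewrite hi.
- by apply: KZ_size_reduced; rewrite hi.
- exact: KZ_pivot_succ.
- exact: KZ_pivot_succ.
have hi0 : A h i = 0 by rewrite KZ_triangular ?hi.
have hj0 : A h j = 0 by rewrite KZ_triangular ?hi.
move=> k l; apply: le_trans (@KZ_shortest i _ (lattice_comb3 l k i j h) _) _.
  exists h; rewrite ?hi ?leqW //.
  by rewrite !mxE hi0 hj0 !mulr0 !add0r gt_eqF ?KZ_diag_gt0.
rewrite (@tail_sum_step _ _ _ j) // (@tail_sum_step _ _ _ h) // tail_sum_last.
  rewrite !mxE (@KZ_triangular j i) // hi0 hj0.
  by rewrite !mulr0 !add0r !addrA.
move=> m hm; rewrite !mxE !(@KZ_triangular m) ?mulr0 ?addr0 ?expr0n //=; lia.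
Qed.

Lemma KZ_half i j : (i <= j <= i + 3)%N -> A i i ^+ 2 <= 2 * A j j ^+ 2.
Proof.
move=> /andP[ij ji]; have := sqr_ge0 (A i i).
have [jE|jE|[jE|jE]] : [\/ i = j, j = i.+1 :> nat | (j = i.+2 :> nat \/ j = i.+3 :> nat)].
  have : [|| j == i :> nat, j == i.+1 :> nat, j == i.+2 :> nat | j == i.+3 :> nat] by lia.
  case/or4P => /eqP jE; [constructor 1; exact: val_inj|constructor 2|constructor 3; left|constructor 3; right] => //.
- by rewrite jE; lra.
- by have := KZ_three_fourths jE; lra.
- by have := KZ_two_thirds jE; lra.
have kn : (i.+2 < n)%N by have := ltn_ord j; lia.
have := @KZ_two_thirds i (Ordinal kn) erefl.
by have := @KZ_three_fourths (Ordinal kn) j jE; lra.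
Qed.

Lemma KZ_quarter i j : (i <= j <= i + 4)%N -> A i i ^+ 2 <= 4 * A j j ^+ 2.
Proof.
move=> /andP[ij ji]; have := sqr_ge0 (A j j).
have [jl|jl] := leqP j (i + 3); first by have := @KZ_half i j; rewrite ij jl => /(_ isT); lra.
have kn : (i.+1 < n)%N by have := ltn_ord j; lia.
have := @KZ_three_fourths i (Ordinal kn) erefl.
have := @KZ_half (Ordinal kn) j; rewrite /= (_ : (i.+1 <= j <= _)%N); last by lia.
by move=> /(_ isT); lra.
Qed.

Lemma dual_col xi j : dual_lattice A xi -> dotv xi (col j A) \is a Num.int.
Proof. by apply; exact: lattice_col. Qed.

End Reduced.

(** * Dual vectors *)

Lemma int_dist_sqr (F : archiRealFieldType) (x t : F) :
  x \is a Num.int -> `|t| <= 1/2 -> t ^+ 2 <= (x - t) ^+ 2.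
Proof.
move=> xint t2; have [->|x0] := eqVneq x 0; first by rewrite sub0r sqrrN.
have x1 := norm_intr_ge1 xint x0; have := lerB_dist x t.
rewrite -[t ^+ 2]real_normK ?num_real // -[(x - t) ^+ 2]real_normK ?num_real //.
by rewrite ler_pXn2r ?nnegrE //; lra.
Qed.

Lemma int_sqr_cases (F : archiRealFieldType) (x : F) :
  x \is a Num.int -> x != 0 -> x ^+ 2 = 1 \/ 4 <= x ^+ 2.
Proof.
move=> /intrP[z ->]; rewrite intr_eq0 -rmorphXn /= => z0.
have [z1|z1] : z ^+ 2 = 1 \/ 4 <= z ^+ 2.
  have [|] : `|z| = 1 \/ 2 <= `|z| by lia.
    by rewrite -[z ^+ 2]real_normK ?num_real // => ->; left.
  by rewrite -[z ^+ 2]real_normK ?num_real // => ?; right; nia.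
by left; rewrite z1.
by right; rewrite -(ler_int F) in z1.
Qed.

Section DualGap.
Context {R : realType} {n : nat} {A : 'M[R]_n}.
Implicit Types (xi : 'cV[R]_n) (i j k : 'I_n).
Context (A_KZ : KZ_reduced A) (A_norm : KZ_normalized A).
Let tri := KZ_triangular A_norm.
Let dpos := KZ_diag_gt0 A_norm.

Lemma dual_first xi i : dual_lattice A xi -> (forall k, (k < i)%N -> xi k 0 = 0) ->
  xi i 0 * A i i \is a Num.int.
Proof.
move=> xiA xi0; have := dual_col i xiA.
rewrite /dotv (@sum_first _ _ i) => [|k /xi0 ->]; last by rewrite mul0r.
by rewrite big1 ?addr0 ?mxE // => k ik; rewrite mxE tri // mulr0.
Qed.

Lemma dual_succ xi i j : dual_lattice A xi -> (forall k, (k < i)%N -> xi k 0 = 0) ->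
  j = i.+1 :> nat -> xi i 0 * A i j + xi j 0 * A j j \is a Num.int.
Proof.
move=> xiA xi0 ji; have := dual_col j xiA.
rewrite /dotv (@sum_first _ _ i) => [|k /xi0 ->]; last by rewrite mul0r.
rewrite (eq_bigl (fun k : 'I_n => (j <= k)%N)); last by move=> k; rewrite ji.
by rewrite tail_sum_last ?mxE // => k jk; rewrite mxE tri // mulr0.
Qed.

(** The integer [xi_i * a_ij + xi_j * a_jj] has [t = xi_i * a_ij] of absolute
    value at most [1/2], so [p_j * D_j >= t ^ 2 = p_i * a_ij ^ 2], and
    [a_ij ^ 2 >= D_i - D_j] because [a_ii] is minimal. *)
Lemma inv_pivot_succ xi i j :
  dual_lattice A xi -> (forall k, (k < i)%N -> xi k 0 = 0) ->
  (xi i 0 * A i i) ^+ 2 = 1 -> j = i.+1 :> nat ->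
  1 <= (xi i 0 ^+ 2 + xi j 0 ^+ 2) * A j j ^+ 2.
Proof.
move=> xiA xi0 xi1 ji.
have xin : `|xi i 0| * A i i = 1.
  rewrite -(gtr0_norm (dpos i)) -normrM.
  by apply/eqP; rewrite -(eqrXn2 (n := 2)) // real_normK ?num_real ?xi1 ?expr1n.
have t2 : `|xi i 0 * A i j| <= 1/2.
  rewrite normrM (_ : 1/2 = `|xi i 0| * (A i i / 2)); last by rewrite mulrA xin.
  apply: ler_wpM2l => //.
  by apply: KZ_size_reduced => //; rewrite ji.
have := int_dist_sqr (dual_succ xiA xi0 ji) t2.
have := KZ_pivot_succ A_KZ A_norm ji.
have := sqr_ge0 (xi i 0); move: xi1; rewrite !exprMn => xi1 x0 h.
have : xi i 0 ^+ 2 * A i i ^+ 2 <= xi i 0 ^+ 2 * (A i j ^+ 2 + A j j ^+ 2).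
  exact: ler_wpM2l.
by lra.
Qed.

(** The term [q ^ 2 / 2] keeps a quantitative gap, so that equality forces
    [q = 0]. It is what remains of [q ^ 2] after paying [2 * p_(i+1) * p_(i+4)] for
    an index at distance four, because [q >= p_(i+1) + p_(i+4)]. *)
Lemma dual_gap xi i : (n <= 5)%N ->
  dual_lattice A xi -> (forall k, (k < i)%N -> xi k 0 = 0) -> xi i 0 != 0 ->
  let s := \sum_(k < n) xi k 0 ^+ 2 in
  let q := \sum_(k < n | (i < k)%N) xi k 0 ^+ 2 in
  let t := \sum_(k < n) xi k 0 ^+ 2 / A k k ^+ 2 in
  t < s ^+ 2 \/ (xi i 0 * A i i) ^+ 2 = 1 /\ t + q ^+ 2 / 2 <= s ^+ 2.
Proof.
move=> n5 xiA xi0 xii s q t.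
have D0 k : 0 < A k k ^+ 2 by rewrite exprn_gt0 ?dpos.
have p0 k : 0 <= xi k 0 ^+ 2 by rewrite sqr_ge0.
have q0 : 0 <= q by rewrite sumr_ge0.
have sE : s = xi i 0 ^+ 2 + q.
  by apply: sum_first => k /xi0 ->; rewrite expr0n.
have tE : t = xi i 0 ^+ 2 / A i i ^+ 2
            + \sum_(k < n | (i < k)%N) xi k 0 ^+ 2 / A k k ^+ 2.
  by apply: sum_first => k /xi0 ->; rewrite expr0n mul0r.
have kint : xi i 0 * A i i != 0 by rewrite mulf_neq0 // gt_eqF.
have pi0 : 0 < xi i 0 ^+ 2 by rewrite exprn_even_gt0.
have in5 k : (k <= i + 4)%N by have := ltn_ord k; lia.
have [k1|k4] := int_sqr_cases (dual_first xiA xi0) kint; last first.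
  left; have sD k : (i <= k)%N -> 1 <= s * A k k ^+ 2.
    move=> ik; have := KZ_quarter A_KZ A_norm (_ : i <= k <= i + 4)%N.
    rewrite ik in5 => /(_ isT) h; move: k4; rewrite exprMn => k4.
    have : xi i 0 ^+ 2 * A i i ^+ 2 <= xi i 0 ^+ 2 * (4 * A k k ^+ 2) by apply: ler_wpM2l.
    have : 0 <= q * A k k ^+ 2 by rewrite mulr_ge0 // ltW.
    by rewrite sE; lra.
  have : \sum_(k < n | (i < k)%N) xi k 0 ^+ 2 / A k k ^+ 2 <= q * s.
    rewrite mulr_suml; apply: ler_sum => k ik.
    by rewrite ler_pdivrMr // -mulrA ler_peMr // sD // ltnW.
  have : xi i 0 ^+ 2 / A i i ^+ 2 < xi i 0 ^+ 2 * s.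
    rewrite ltr_pdivrMr // -mulrA ltr_pMr //.
    move: k4; rewrite exprMn sE mulrDl => k4.
    have : 0 <= q * A i i ^+ 2 by rewrite mulr_ge0 // ltW.
    lra.
  have -> : s ^+ 2 = xi i 0 ^+ 2 * s + q * s by rewrite expr2 {1}sE mulrDl.
  rewrite tE; lra.
right; split=> //.
have Di : (A i i ^+ 2)^-1 = xi i 0 ^+ 2.
  by apply: (mulIf (lt0r_neq0 (D0 i))); rewrite mulVf ?gt_eqF // -exprMn k1.
have near k : (i <= k <= i + 3)%N ->
    xi k 0 ^+ 2 / A k k ^+ 2 <= xi k 0 ^+ 2 * (2 * xi i 0 ^+ 2).
  move=> /(KZ_half A_KZ A_norm) h; apply: ler_wpM2l => //.
  rewrite -[leLHS]mul1r ler_pdivrMr //.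
  by have := ler_wpM2l (ltW pi0) h; rewrite -exprMn k1; lra.
suff : \sum_(k < n | (i < k)%N) xi k 0 ^+ 2 / A k k ^+ 2 <=
    q * (2 * xi i 0 ^+ 2) + q ^+ 2 / 2.
  by rewrite tE sE Di; lra.
(* An index at distance four from [i] exists only in the second case, which
   means [n = 5] and [i = 0]. *)
have [n4|n4] := leqP n (i + 4).
  apply: (@le_trans _ _ (q * (2 * xi i 0 ^+ 2))); last by rewrite lerDl divr_ge0 ?sqr_ge0.
  rewrite mulr_suml; apply: ler_sum => k ik; apply: near.
  by rewrite ltnW //=; have := ltn_ord k; lia.
have j1n : (i.+1 < n)%N by lia.
pose j1 := Ordinal j1n; pose j4 := Ordinal n4.
have ij4 : (i < j4)%N by rewrite /=; lia.
have ij1 : (i < j1)%N by rewrite /=; lia.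
have j14 : j1 != j4 by rewrite -val_eqE /=; lia.
have far : xi j4 0 ^+ 2 / A j4 j4 ^+ 2 <=
    xi j4 0 ^+ 2 * (2 * (xi i 0 ^+ 2 + xi j1 0 ^+ 2)).
  apply: ler_wpM2l => //.
  have h1 := inv_pivot_succ xiA xi0 k1 (erefl : j1 = i.+1 :> nat).
  have h2 : A j1 j1 ^+ 2 <= 2 * A j4 j4 ^+ 2 by apply: KZ_half => //=; lia.
  rewrite -[leLHS]mul1r ler_pdivrMr // (le_trans h1) //.
  rewrite [2 * _]mulrC -mulrA; apply: ler_wpM2l => //.
  by rewrite addr_ge0.
have rest : \sum_(k < n | (i < k)%N && (k != j4)) xi k 0 ^+ 2 / A k k ^+ 2 <=
    (\sum_(k < n | (i < k)%N && (k != j4)) xi k 0 ^+ 2) * (2 * xi i 0 ^+ 2).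
  rewrite mulr_suml; apply: ler_sum => k /andP[ik kj]; apply: near.
  rewrite ltnW //=; move: kj; rewrite -val_eqE /=; have := ltn_ord k; lia.
have qE : q = xi j4 0 ^+ 2 + \sum_(k < n | (i < k)%N && (k != j4)) xi k 0 ^+ 2.
  by rewrite /q (bigD1 j4).
have r1 : xi j1 0 ^+ 2 <= \sum_(k < n | (i < k)%N && (k != j4)) xi k 0 ^+ 2.
  by rewrite (bigD1 j1) /= ?lerDl ?sumr_ge0 // j14 andbT.
rewrite (bigD1 j4) //=.
have q2 : 4 * (xi j1 0 ^+ 2 * xi j4 0 ^+ 2) <= q ^+ 2.
  apply: (@le_trans _ _ ((xi j1 0 ^+ 2 + xi j4 0 ^+ 2) ^+ 2)).
    have := sqr_ge0 (xi j1 0 ^+ 2 - xi j4 0 ^+ 2); lra.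
  by rewrite ler_pXn2r ?nnegrE ?addr_ge0 // qE; lra.
rewrite {1}qE; lra.
Qed.

Lemma first_nonzero xi : xi != 0 ->
  exists2 i, xi i 0 != 0 & forall k, (k < i)%N -> xi k 0 = 0.
Proof.
move=> xi0; have [i0 hi0] : exists i, xi i 0 != 0.
  apply/existsP; apply: contra_neqT xi0 => /existsPn h.
  by apply/matrixP => k l; rewrite ord1 mxE; apply/eqP; have := h k; rewrite negbK.
exists [arg min_(i < i0 | xi i 0 != 0) (i : nat)]; case: arg_minnP => // i hi imin k ki.
by apply/eqP; apply: contraLR ki => /imin; rewrite -leqNgt.
Qed.

Lemma enorm4 xi : enorm xi ^+ 4 = (\sum_(k < n) xi k 0 ^+ 2) ^+ 2.
Proof. by rewrite -enorm_sqr -exprM. Qed.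

Lemma dual_norm_ge xi : (n <= 5)%N -> dual_lattice A xi -> xi != 0 ->
  \sum_(k < n) xi k 0 ^+ 2 / A k k ^+ 2 <= enorm xi ^+ 4.
Proof.
move=> n5 xiA /first_nonzero[i xii xi0]; rewrite enorm4.
case: (dual_gap n5 xiA xi0 xii) => [/ltW //|[_]]; apply: le_trans.
by rewrite lerDl divr_ge0 ?sqr_ge0.
Qed.

Lemma dual_eq_case xi : (n <= 5)%N -> dual_lattice A xi -> xi != 0 ->
  enorm xi ^+ 4 = \sum_(k < n) xi k 0 ^+ 2 / A k k ^+ 2 ->
  exists i, (xi = (A i i)^-1 *: stdbasis i \/ xi = - ((A i i)^-1 *: stdbasis i))
    /\ (forall j, (i < j)%N -> A i j = 0).
Proof.
move=> n5 xiA /first_nonzero[i xii xi0]; rewrite enorm4 => eqxi; exists i.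
have := dual_gap n5 xiA xi0 xii; rewrite /= eqxi ltxx => -[//|[xi1]].
set q := \sum_(k < n | (i < k)%N) _; rewrite gerDl => q_le0.
have q0 : q = 0.
  by apply/eqP; rewrite -sqrf_eq0 eq_le sqr_ge0 andbT; lra.
have xi_gt k : (i < k)%N -> xi k 0 = 0.
  move=> ik; move/eqP: q0; rewrite psumr_eq0 => [|l _]; last exact: sqr_ge0.
  by move=> /allP/(_ k (mem_index_enum k)); rewrite ik /= sqrf_eq0 => /eqP.
have xiE : xi = xi i 0 *: stdbasis i.
  apply/matrixP => k l; rewrite ord1 !mxE andbT.
  case: (ltngtP k i) => [ki|ik|/val_inj ->]; last by rewrite eqxx mulr1.
    by rewrite xi0 // (negbTE (_ : k != i)) ?mulr0 // neq_ltn ki.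
  by rewrite xi_gt // (negbTE (_ : k != i)) ?mulr0 // neq_ltn ik orbT.
have an0 : A i i != 0 by rewrite gt_eqF.
have xiV : xi i 0 = (A i i)^-1 \/ xi i 0 = - (A i i)^-1.
  have /orP[] : (xi i 0 * A i i == 1) || (xi i 0 * A i i == - 1).
    by rewrite -eqf_sqr xi1 expr1n.
    by move=> /eqP h; left; apply: (mulIf an0); rewrite mulVf.
  by move=> /eqP h; right; apply: (mulIf an0); rewrite mulNr mulVf.
split.
  by rewrite {1 2}xiE; case: xiV => ->; [left | right; rewrite scaleNr].
move=> j ij; have := dual_col j xiA.
rewrite /dotv (@sum_first _ _ i) => [|k /xi0 ->]; last by rewrite mul0r.
rewrite big1 ?addr0 ?mxE => [xint|k /xi_gt ->]; last by rewrite mul0r.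
have xin : `|xi i 0| = (A i i)^-1.
  by case: xiV => ->; rewrite ?normrN gtr0_norm ?invr_gt0.
have small : `|xi i 0 * A i j| <= 1/2.
  rewrite normrM xin mulrC ler_pdivrMr //.
  by have := KZ_size_reduced A_KZ A_norm ij; lra.
have [/eqP|xn0] := eqVneq (xi i 0 * A i j) 0.
  by rewrite mulf_eq0 (negbTE xii) => /eqP.
by have := norm_intr_ge1 xint xn0; lra.
Qed.

End DualGap.

Lemma spanning_coord_neq0 (R : realType) (n : nat) (S : set 'cV[R]_n) (i : 'I_n) :
  spans_space S -> exists2 u, S u & u i 0 != 0.
Proof.
move=> /(_ (stdbasis i))[s sS ei].
have [/hasP[u us ui]|/hasPn s0] := boolP (has (fun u : 'cV[R]_n => u i 0 != 0) s).
  by exists u => //; apply: sS.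
have : stdbasis i i 0 = 0 :> R.
  rewrite (@coord_span _ _ _ (in_tuple s) _ ei) summxE big1 // => k _.
  rewrite mxE; have /s0 : s`_k \in s by apply: mem_nth.
  by rewrite negbK => /eqP ->; rewrite mulr0.
by rewrite mxE !eqxx => /eqP; rewrite oner_eq0.
Qed.

Unset Implicit Arguments.

Theorem proposition4p3 (R : realType) (n : nat) (A : 'M[R]_n)
    (n_in : n \in [:: 3; 4; 5]%N)
    (A_unit : A \in unitmx)
    (A_KZ : KZ_reduced A)
    (A_norm : KZ_normalized A) :
  [/\ forall xi : 'cV[R]_n, dual_lattice A xi -> xi != 0 ->
        enorm xi ^+ 4 >= \sum_(i < n) xi i 0 ^+ 2 / A i i ^+ 2,
      forall xi : 'cV[R]_n, dual_lattice A xi -> xi != 0 ->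
        (enorm xi ^+ 4 = \sum_(i < n) xi i 0 ^+ 2 / A i i ^+ 2 <->
         exists i : 'I_n,
           (xi = (A i i)^-1 *: stdbasis i \/ xi = - ((A i i)^-1 *: stdbasis i)) /\
           (forall j : 'I_n, (i < j)%N -> A i j = 0))
    & forall S : set 'cV[R]_n,
        (forall xi, S xi ->
           [/\ dual_lattice A xi, xi != 0 &
               enorm xi ^+ 4 = \sum_(i < n) xi i 0 ^+ 2 / A i i ^+ 2]) ->
        spans_space S ->
        is_diag_mx A].
Proof.
have n5 : (n <= 5)%N by move: n_in; rewrite !inE => /or3P[] /eqP ->.
split=> [xi xiA xi0|xi xiA xi0|S SE Sspan].
- exact: dual_norm_ge.
- split; first exact: dual_eq_case.
  move=> [i [xiE _]].
  have xik k : k != i -> xi k 0 ^+ 2 = 0.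
    by move=> ki; case: xiE => ->; rewrite !mxE (negbTE ki) mulr0 ?oppr0 expr0n.
  have xii : xi i 0 ^+ 2 = (A i i ^+ 2)^-1.
    by case: xiE => ->; rewrite !mxE !eqxx mulr1 ?sqrrN exprVn.
  rewrite enorm4 (bigD1 i) //= big1 ?addr0 => [|k /xik //].
  rewrite (bigD1 i) //= big1 ?addr0 => [|k /xik ->]; last by rewrite mul0r.
  by rewrite xii expr2.
- apply/is_diag_mxP => i j; rewrite neq_ltn => /orP[ij|]; last first.
    exact: KZ_triangular.
  have [xi /SE[xiA xi0 eqxi] xii] := spanning_coord_neq0 i Sspan.
  have [k [xiE Ak]] := dual_eq_case A_KZ A_norm n5 xiA xi0 eqxi.
  have ik : i = k.
    by apply: contra_neq_eq xii => ik; case: xiE => ->;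
       rewrite !mxE (negbTE ik) mulr0 ?oppr0.
  by rewrite ik Ak // -ik.
Qed.
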